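(* The data $(U_-,X)$ are informative for quadratic stabilization if and only if there exist matrices $P\in\mathbb{R}^{n\times n}$ with $P>0$, $L\in\mathbb{R}^{m\times n}$ and scalars $\alpha\geq 0$, $\beta>0$ such that $$\begin{bmatrix} P-\beta I & 0 & BL\\ 0 & 0 & P\\ L^\top B^\top & P & P\end{bmatrix}-\alpha\begin{bmatrix} N & 0\\ 0 & 0\end{bmatrix}\geq 0,$$ where $N\in\mathbb{R}^{2n\times 2n}$ occupies the upper-left $2n\times 2n$ block. Moreover, in this case the gain $K:=LP^{-1}$ stabilizes all systems in $\Sigma$ (that is, for every $A\in\Sigma$ the system $x(t+1)=(A+BK)x(t)$ is asymptotically stable).
   Context: All matrices are real; $P>0$ (resp. $\geq 0$, $<0$) means symmetric positive definite (resp. positive semidefinite, negative definite). System: $x(t+1)=A_sx(t)+Bu(t)+w(t)$ with $x(t),w(t)\in\mathbb{R}^n$, $u(t)\in\mathbb{R}^m$. It is the aggregate of $r$ agents with state and input dimensions $n_i,m_i$ ($n=\sum n_i$, $m=\sum m_i$), and $B=\mathrm{diag}(B_1,\dots,B_r)\in\mathbb{R}^{n\times m}$ with $B_i\in\mathbb{R}^{n_i\times m_i}$. $B$ is known, $A_s\in\mathbb{R}^{n\times n}$ is unknown. Data: on a time window of length $T$ one measures $X=[x(0)\ \cdots\ x(T)]$ and $U_-=[u(0)\ \cdots\ u(T-1)]$; set $X_+=[x(1)\ \cdots\ x(T)]$, $X_-=[x(0)\ \cdots\ x(T-1)]$. The noise matrix $W_-=[w(0)\ \cdots\ w(T-1)]$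 is not measured, but is assumed to satisfy $$\begin{bmatrix} I\\ W_-^\top\end{bmatrix}^\top\Phi\begin{bmatrix} I\\ W_-^\top\end{bmatrix}\geq 0,\qquad \Phi=\begin{bmatrix}\Phi_{11}&\Phi_{12}\\ \Phi_{12}^\top&\Phi_{22}\end{bmatrix}\qquad( * )$$ for a given matrix $\Phi$ with $\Phi_{11}=\Phi_{11}^\top\in\mathbb{R}^{n\times n}$, $\Phi_{12}\in\mathbb{R}^{n\times T}$, $\Phi_{22}=\Phi_{22}^\top\in\mathbb{R}^{T\times T}$, $\Phi_{22}<0$. The data are generated by the true system $(A_s,B)$ with noise satisfying $( * )$. The set of state matrices compatible with the data is $\Sigma=\{A\in\mathbb{R}^{n\times n}\mid W_-=X_+-AX_--BU_-\text{ satisfies }( * )\}$; in particular $A_s\in\Sigma$. Define $$N:=\begin{bmatrix} I & X_+-BU_-\\ 0&-X_-\end{bmatrix}\Phi\begin{bmatrix} I & X_+-BU_-\\ 0&-X_-\end{bmatrix}^\top .$$ Definition: the data $(U_-,X)$ are informative for quadratic stabilization if there exist a feedback gain $K\in\mathbb{R}^{m\times n}$ and a matrix $P>0$ such that $(A+BK)P(A+BK)^\top<P$ for every $A\in\Sigma$. *)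

(* Defs.v *)
From mathcomp Require Import all_boot all_order all_algebra.
From mathcomp Require Import all_classical all_reals all_analysis.
Set Implicit Arguments.
Unset Strict Implicit.
Unset Printing Implicit Defensive.
Import Order.TTheory GRing.Theory Num.Theory.
Import numFieldNormedType.Exports.
Local Open Scope classical_set_scope.
Local Open Scope ring_scope.

(* Definiteness includes symmetry. The Loewner order M < N is
   [posdef (N - M)], and M < 0 is [posdef (- M)]. *)
Definition posdef (R : realType) (n : nat) (M : 'M[R]_n) : Prop :=
  M^T = M /\ forall v : 'cV[R]_n, v != 0 -> 0 < (v^T *m M *m v) 0 0.

Definition possemidef (R : realType) (n : nat) (M : 'M[R]_n) : Prop :=
  M^T = M /\ forall v : 'cV[R]_n, 0 <= (v^T *m M *m v) 0 0.

(* diag(B_1, ..., B_r) for rectangular blocks ([\mxdiag] only takes square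
   ones). On the diagonal j = i, and [conform_mx] merely retypes B_ i from
   'M_(n_ i, m_ i) to 'M_(n_ i, m_ j). *)
Definition block_diag (R : realType) (r : nat) (n_ m_ : 'I_r -> nat)
    (B_ : forall i : 'I_r, 'M[R]_(n_ i, m_ i)) :
    'M[R]_(\sum_i n_ i, \sum_i m_ i) :=
  \mxblock_(i < r, j < r)
    (if i == j then conform_mx (0 : 'M[R]_(n_ i, m_ j)) (B_ i) else 0).

(* [s 0, ..., s (k - 1)] *)
Definition samples (R : realType) (p k : nat) (s : nat -> 'cV[R]_p) :
    'M[R]_(p, k) :=
  \matrix_(i < p, t < k) s t i 0.

(* For X = [x(0), ..., x(T)]: X_- drops the last column, X_+ the first. *)
Definition Xminus (R : realType) (n T : nat) (X : 'M[R]_(n, T.+1)) :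
    'M[R]_(n, T) :=
  colsub (widen_ord (leqnSn T)) X.

Definition Xplus (R : realType) (n T : nat) (X : 'M[R]_(n, T.+1)) :
    'M[R]_(n, T) :=
  colsub (lift ord0) X.

Definition noise_bound (R : realType) (n T : nat) (Phi : 'M[R]_(n + T))
    (W : 'M[R]_(n, T)) : Prop :=
  let IW : 'M[R]_(n + T, n) := col_mx 1%:M W^T in
  possemidef (IW^T *m Phi *m IW).

Definition compatible (R : realType) (n m T : nat) (B : 'M[R]_(n, m))
    (Phi : 'M[R]_(n + T)) (U : 'M[R]_(m, T)) (X : 'M[R]_(n, T.+1)) :
    set 'M[R]_n :=
  [set A | noise_bound Phi (Xplus X - A *m Xminus X - B *m U)].

Definition informative_quad_stab (R : realType) (n m T : nat)
    (B : 'M[R]_(n, m)) (Phi : 'M[R]_(n + T)) (U : 'M[R]_(m, T))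
    (X : 'M[R]_(n, T.+1)) : Prop :=
  exists (K : 'M[R]_(m, n)) (P : 'M[R]_n), posdef P /\
    forall A : 'M[R]_n, compatible B Phi U X A ->
      posdef (P - (A + B *m K) *m P *m (A + B *m K)^T).

Definition data_N (R : realType) (n m T : nat) (B : 'M[R]_(n, m))
    (Phi : 'M[R]_(n + T)) (U : 'M[R]_(m, T)) (X : 'M[R]_(n, T.+1)) :
    'M[R]_(n + n) :=
  let D : 'M[R]_(n + n, n + T) :=
    block_mx 1%:M (Xplus X - B *m U) 0 (- Xminus X) in
  D *m Phi *m D^T.

Definition stab_lmi (R : realType) (n m : nat) (B : 'M[R]_(n, m))
    (N : 'M[R]_(n + n)) (P : 'M[R]_n) (L : 'M[R]_(m, n)) (alpha beta : R) :
    Prop :=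
  let M : 'M[R]_(n + n + n) :=
    block_mx (block_mx (P - beta%:M) 0 0 0) (col_mx (B *m L) P)
             (row_mx (L^T *m B^T) P)        P in
  possemidef (M - alpha *: block_mx N 0 0 0).

(* x(t+1) = F x(t): the origin is Lyapunov stable and every trajectory
   converges to it. The norm is the max norm on 'cV[R]_n. *)
Definition asymptotically_stable (R : realType) (n : nat) (F : 'M[R]_n) :
    Prop :=
  let trajectory (x : nat -> 'cV[R]_n) := forall t, x t.+1 = F *m x t in
  (forall e : R, 0 < e -> exists2 d : R, 0 < d &
     forall x, trajectory x -> `|x 0%N| < d -> forall t, `|x t| < e) /\
  (forall x, trajectory x -> x t @[t --> \oo] --> (0 : 'cV[R]_n)).

(* Main.v *)
Require Import Defs.
From mathcomp Require Import all_boot all_order all_algebra.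
From mathcomp Require Import all_classical all_reals all_analysis.
From mathcomp Require Import ring lra.
Import Order.TTheory GRing.Theory Num.Theory.
Import numFieldNormedType.Exports.
Local Open Scope classical_set_scope.
Local Open Scope ring_scope.
Set Implicit Arguments.
Unset Strict Implicit.
Unset Printing Implicit Defensive.

(** Write [qmi N A] for [[I A] N [I A]^T].  The data matrix is
    [N = D Phi D^T], where [[I A] D = [I W]] for the noise matrix [W] that [A]
    would require, so the compatible matrices are those with
    [qmi N A >= 0].  For [K = L P^-1], the matrix
    [M = diag(P, 0) - C P^-1 C^T], [C = col_mx (B L) P], satisfies
    [qmi M A = P - (A + B K) P (A + B K)^T], and it is the Schur complement of
    [P] in the matrix of the LMI without its [alpha] and [beta] terms.  So the
    LMI says exactly that [M - alpha N >= diag(beta I, 0)] ([stab_lmiP]), and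
    the theorem is an S-lemma between the quadratic matrix inequalities of [N]
    and [M].

    The LMI is sufficient because congruence by [[I A]] turns it into
    [qmi M A >= beta I + alpha (qmi N A)] ([lmi_decrease]).

    For necessity the matrix problem is reduced to one about vectors.  First,
    the lower right block of [N] is negative definite: along a null direction
    [g] the compatible set would contain the line [A0 + s g g^T], on which
    [(A + B K) P (A + B K)^T] is unbounded ([qmi_curvature_posdef]).  After
    completing the square, every vector [z = (p, q)] with [p != 0] and
    [z^T N z >= 0] is of the form [(p, A^T p)] with [A] compatible
    ([qmi_interpolation]).  Hence [z^T M z > 0] whenever [z != 0] and
    [z^T N z >= 0], and the strict S-lemma for two quadratic forms
    ([S_lemma_strict]) provides the multiplier.  By compactness of
    the sphere the implication survives a small perturbation of both forms,
    which supplies, unless [N] is negative definite, a strictly positive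
    direction, and a two-dimensional argument ([S_lemma_ratio]) separates the
    ratios of the two forms on the two signs of the perturbed [N].

    Stability comes from the Lyapunov function [v^T P^-1 v]: the decrease of
    [P] along [F^T] by [beta I] yields a contraction factor [rho < 1] for
    [P^-1] along [F], by the weighted inequality [young_posdef]. *)


(** * Quadratic forms *)

Definition bform (R : realType) (k : nat) (M : 'M[R]_k) (u v : 'cV[R]_k) : R :=
  (u^T *m M *m v) 0 0.

Section BForm.
Variable R : realType.
Implicit Types k l : nat.

Lemma bformDl k (M : 'M[R]_k) u v w :
  bform M (u + v) w = bform M u w + bform M v w.
Proof. by rewrite /bform linearD /= !mulmxDl mxE. Qed.

Lemma bformDr k (M : 'M[R]_k) u v w :
  bform M w (u + v) = bform M w u + bform M w v.
Proof. by rewrite /bform mulmxDr mxE. Qed.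

Lemma bformZl k (M : 'M[R]_k) a u v : bform M (a *: u) v = a * bform M u v.
Proof. by rewrite /bform linearZ /= -!scalemxAl mxE. Qed.

Lemma bformZr k (M : 'M[R]_k) a u v : bform M u (a *: v) = a * bform M u v.
Proof. by rewrite /bform -scalemxAr mxE. Qed.

Lemma bformNl k (M : 'M[R]_k) u v : bform M (- u) v = - bform M u v.
Proof. by rewrite -scaleN1r bformZl mulN1r. Qed.

Lemma bformNr k (M : 'M[R]_k) u v : bform M u (- v) = - bform M u v.
Proof. by rewrite -scaleN1r bformZr mulN1r. Qed.

Lemma bform0l k (M : 'M[R]_k) v : bform M 0 v = 0.
Proof. by rewrite /bform linear0 !mul0mx mxE. Qed.

Lemma bformMD k (M N : 'M[R]_k) u v :
  bform (M + N) u v = bform M u v + bform N u v.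
Proof. by rewrite /bform mulmxDr mulmxDl mxE. Qed.

Lemma bformMN k (M : 'M[R]_k) u v : bform (- M) u v = - bform M u v.
Proof. by rewrite /bform mulmxN mulNmx mxE. Qed.

Lemma bformMZ k a (M : 'M[R]_k) u v : bform (a *: M) u v = a * bform M u v.
Proof. by rewrite /bform -scalemxAr -scalemxAl mxE. Qed.

Lemma bformC k (M : 'M[R]_k) u v : M^T = M -> bform M u v = bform M v u.
Proof.
move=> Ms; have -> : bform M u v = (u^T *m M *m v)^T 0 0 by rewrite [RHS]mxE.
by rewrite !trmx_mul trmxK Ms mulmxA.
Qed.

Lemma bform_congr k l (G : 'M[R]_(k, l)) (M : 'M[R]_l) u v :
  bform (G *m M *m G^T) u v = bform M (G^T *m u) (G^T *m v).
Proof. by rewrite /bform trmx_mul trmxK !mulmxA. Qed.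

Lemma bform_mulmxr k (M S : 'M[R]_k) u v : bform M u (S *m v) = bform (M *m S) u v.
Proof. by rewrite /bform !mulmxA. Qed.

Lemma bform_col_mx0 k l (Z : 'M[R]_k) (p u : 'cV[R]_k) (q v : 'cV[R]_l) :
  bform (block_mx Z 0 0 0) (col_mx p q) (col_mx u v) = bform Z p u.
Proof.
by rewrite /bform tr_col_mx mul_row_block mul_row_col !(mulmx0, mul0mx, addr0).
Qed.

Lemma bform1_col_mx k l (p : 'cV[R]_k) (q : 'cV[R]_l) :
  bform 1%:M (col_mx p q) (col_mx p q) = bform 1%:M p p + bform 1%:M q q.
Proof. by rewrite /bform !mulmx1 tr_col_mx mul_row_col mxE. Qed.

Lemma bform1_sum k (v : 'cV[R]_k) : bform 1%:M v v = \sum_i v i 0 ^+ 2.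
Proof. by rewrite /bform mulmx1 mxE; apply: eq_bigr => i _; rewrite mxE expr2. Qed.

Lemma bform1_ge0 k (v : 'cV[R]_k) : 0 <= bform 1%:M v v.
Proof. by rewrite bform1_sum sumr_ge0 // => i _; rewrite sqr_ge0. Qed.

Lemma sqr_entry_le k (v : 'cV[R]_k) i : v i 0 ^+ 2 <= bform 1%:M v v.
Proof.
by rewrite bform1_sum (bigD1 i) //= lerDl sumr_ge0 // => j _; rewrite sqr_ge0.
Qed.

Lemma bform1_gt0 k (v : 'cV[R]_k) : v != 0 -> 0 < bform 1%:M v v.
Proof.
move=> /cV0Pn[i vi]; apply: lt_le_trans (sqr_entry_le v i).
by rewrite exprn_even_gt0 //= vi.
Qed.

Lemma bform_sum k (M : 'M[R]_k) u v :
  bform M u v = \sum_j \sum_i u i 0 * M i j * v j 0.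
Proof.
rewrite /bform mxE; apply: eq_bigr => j _; rewrite mxE mulr_suml.
by apply: eq_bigr => i _; rewrite mxE.
Qed.

Lemma bform_bounded k (M : 'M[R]_k) :
  exists2 c : R, 0 < c & forall v, `|bform M v v| <= c * bform 1%:M v v.
Proof.
exists (1 + \sum_j \sum_i `|M i j|).
  by rewrite ltr_wpDr // sumr_ge0 // => j _; rewrite sumr_ge0.
move=> v; rewrite mulrDl mul1r; apply: ler_wpDl; first exact: bform1_ge0.
rewrite bform_sum mulr_suml; apply: le_trans (ler_norm_sum _ _ _) _.
apply: ler_sum => j _; rewrite mulr_suml; apply: le_trans (ler_norm_sum _ _ _) _.
apply: ler_sum => i _; rewrite !normrM mulrAC mulrC ler_wpM2l //.
have := sqr_entry_le v i; have := sqr_entry_le v j.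
rewrite -(real_normK (num_real (v i 0))) -(real_normK (num_real (v j 0))).
have := sqr_ge0 (`|v i 0| - `|v j 0|); nra.
Qed.

Lemma posdef_unitmx k (P : 'M[R]_k) : posdef P -> P \in unitmx.
Proof.
case=> _ Pp; rewrite -row_free_unit -kermx_eq0; apply/rowV0P => u /sub_kermxP uP.
apply/eqP; apply: contraT => u0; have /Pp : u^T != 0 by rewrite trmx_eq0.
by rewrite trmxK uP mul0mx mxE ltxx.
Qed.

Lemma posdef_ge0 k (P : 'M[R]_k) v : posdef P -> 0 <= bform P v v.
Proof.
move=> [_ Pp]; have [->|/Pp/ltW//] := eqVneq v 0; by rewrite bform0l.
Qed.

Lemma sym_congr k l (G : 'M[R]_(k, l)) (M : 'M[R]_l) :
  M^T = M -> (G *m M *m G^T)^T = G *m M *m G^T.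
Proof. by move=> Ms; rewrite !trmx_mul trmxK Ms !mulmxA. Qed.

(** With [q] shifted by [S^-1 C^T p], the form of the block matrix splits into
    that of the Schur complement and that of [S]. Here [S] is
    positive for the LMI and negative for the data matrix. *)
Lemma bform_complete_square k l (Z : 'M[R]_k) (C : 'M[R]_(k, l)) (S : 'M[R]_l)
    p q : S^T = S -> S \in unitmx ->
  bform (block_mx Z C C^T S) (col_mx p q) (col_mx p q) =
  bform (Z - C *m invmx S *m C^T) p p
  + bform S (q + invmx S *m C^T *m p) (q + invmx S *m C^T *m p).
Proof.
move=> Ss Su; rewrite !(bformDl, bformDr, bformMD, bformMN).
rewrite /bform tr_col_mx mul_row_block mul_row_col !mulmxDl !trmx_mul trmxK.
rewrite trmx_inv Ss !mulmxA.
rewrite mulmxKV // (mulmxK Su) !mxE.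
by ring.
Qed.

Lemma possemidef_schur k l (Z : 'M[R]_k) (C : 'M[R]_(k, l)) (P : 'M[R]_l) :
  posdef P ->
  possemidef (block_mx Z C C^T P) <-> possemidef (Z - C *m invmx P *m C^T).
Proof.
move=> Pp; have Pu := posdef_unitmx Pp; have [Ps _] := Pp.
have Cs : (C *m invmx P *m C^T)^T = C *m invmx P *m C^T.
  by apply: sym_congr; rewrite trmx_inv Ps.
split=> [[Ms Mp]|[Ms Mp]]; split.
- have := congr1 ulsubmx Ms; rewrite tr_block_mx !block_mxKul => Zs.
  by rewrite linearB /= Zs Cs.
- move=> p; have := Mp (col_mx p (- (invmx P *m C^T *m p))).
  by rewrite -!/(bform _ _ _) bform_complete_square // addNr bform0l addr0.
- rewrite tr_block_mx trmxK Ps; congr block_mx.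
  by move: Ms; rewrite linearB /= Cs => /addIr.
- move=> v; rewrite -/(bform _ _ _) -[v]vsubmxK bform_complete_square //.
  by apply: addr_ge0; [exact: Mp | exact: posdef_ge0].
Qed.

End BForm.

(** * The strict S-lemma *)

Section SLemma.
Variable R : realType.
Implicit Types k l : nat.

Lemma continuous_sum (T : topologicalType) (I : Type) (s : seq I)
    (f : I -> T -> R) :
  (forall i, continuous (f i)) -> continuous (fun z => \sum_(i <- s) f i z).
Proof.
move=> fc; elim: s => [|i s IH] z.
  by under eq_fun do rewrite big_nil; exact: cvg_cst.
by under eq_fun do rewrite big_cons; apply: cvgD; [exact: fc | exact: IH].
Qed.

Lemma continuous_bform k (M : 'M[R]_k) :
  continuous (fun z : 'rV[R]_k => bform M z^T z^T).
Proof.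
have -> : (fun z : 'rV[R]_k => bform M z^T z^T) =
   (fun z : 'rV[R]_k => \sum_j \sum_i z 0 i * M i j * z 0 j).
  apply/funext => z; rewrite bform_sum; apply: eq_bigr => j _.
  by apply: eq_bigr => i _; rewrite !mxE.
apply: continuous_sum => j; apply: continuous_sum => i z /=.
have coord (l : 'I_k) : continuous (fun y : 'rV[R]_k => y 0 l) by exact: coord_continuous.
apply: (@continuousM _ _ (fun y : 'rV[R]_k => y 0 i * M i j) (fun y => y 0 j)).
  apply: (@continuousM _ _ (fun y : 'rV[R]_k => y 0 i) (fun=> M i j)).
    exact: coord.
  exact: cst_continuous.
exact: coord.
Qed.

Lemma compact_sphere k : compact [set z : 'rV[R]_k | bform 1%:M z^T z^T = 1].
Proof.
apply: bounded_closed_compact.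
  exists 1; split; first exact: num_real.
  move=> b b1 z /= z1.
  rewrite [leLHS]/Num.norm /= mx_normrE; apply/bigmax_leP; split=> /=.
    exact: ltW (lt_trans ltr01 b1).
  move=> [i j] _ /=; rewrite (ord1 i); apply: ltW; apply: le_lt_trans b1.
  have := sqr_entry_le z^T j; rewrite z1 mxE -(real_normK (num_real _)).
  by rewrite expr_le1.
have -> : [set z : 'rV[R]_k | bform 1%:M z^T z^T = 1] =
          (fun z : 'rV[R]_k => bform 1%:M z^T z^T) @^-1` [set 1] by [].
apply: preimage_closed; last exact: closed_eq.
by move=> z _; exact: continuous_bform.
Qed.

(** The maximum of two forms is continuous, so it attains a positive minimum
    on the compact Euclidean sphere; homogeneity extends the bound to all
    vectors. *)
Lemma homogeneous_max_bound k (M N : 'M[R]_k) :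
  (forall z, z != 0 -> 0 < Num.max (bform M z z) (bform N z z)) ->
  exists2 mu : R, 0 < mu &
    forall z, mu * bform 1%:M z z <= Num.max (bform M z z) (bform N z z).
Proof.
move=> pos.
pose S := [set z : 'rV[R]_k | bform 1%:M z^T z^T = 1].
pose g (z : 'rV[R]_k) := Num.max (bform M z^T z^T) (bform N z^T z^T).
have gc : {within S, continuous g}.
  apply: continuous_subspaceT => z.
  apply: (@continuous_max _ _ (fun z : 'rV[R]_k => bform M z^T z^T)
                              (fun z => bform N z^T z^T)).
    exact: continuous_bform.
  exact: continuous_bform.
have normalize (z : 'cV[R]_k) : z != 0 ->
    exists2 s : R, s ^+ 2 = bform 1%:M z z & S (s^-1 *: z^T) /\ 0 < s.
  move=> z0; have zz := bform1_gt0 z0; exists (Num.sqrt (bform 1%:M z z)).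
    by rewrite sqr_sqrtr // ltW.
  rewrite sqrtr_gt0; split=> //; rewrite /S /= linearZ /= trmxK bformZl bformZr.
  by rewrite mulrA -invfM -expr2 sqr_sqrtr ?(ltW zz) // mulVf // gt_eqF.
have [nz|/existsNP[z /eqP z0]] := pselect (forall z : 'cV[R]_k, z = 0).
  by exists 1 => // z; rewrite (nz z) !bform0l mulr0 maxxx.
have S0 : S !=set0 by have [s _ [Ss _]] := normalize _ z0; exists (s^-1 *: z^T).
have [z1 /set_mem Sz1 gmin] := EVT_min_rV S0 (@compact_sphere k) gc.
exists (g z1).
  apply: pos; rewrite trmx_eq0; apply/eqP => z10; move: Sz1.
  by rewrite /S /= z10 linear0 bform0l => /esym/eqP; rewrite oner_eq0.
move=> y; have [->|y0] := eqVneq y 0; first by rewrite !bform0l mulr0 maxxx.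
have [s ss [Ss s0]] := normalize _ y0.
have /gmin : s^-1 *: y^T \in S by rewrite inE.
rewrite {2}/g linearZ /= trmxK !bformZl !bformZr !mulrA -maxr_pMr; last first.
  by rewrite mulr_ge0 // invr_ge0 ltW.
by rewrite -invfM -expr2 ss mulrC ler_pdivlMr // bform1_gt0.
Qed.

(** A quadratic polynomial whose constant and leading coefficients have
    opposite signs has one root on each side of [0]. *)
Lemma line_through_zero (a b c : R) : 0 < a -> c < 0 ->
  exists t1 t2 : R, [/\ t1 < 0, 0 < t2, t1 * t2 = a / c,
    a + 2 * t1 * b + t1 ^+ 2 * c = 0 & a + 2 * t2 * b + t2 ^+ 2 * c = 0].
Proof.
move=> a0 c0; have c0' : c != 0 by rewrite lt_eqF.
pose d := Num.sqrt (b ^+ 2 - a * c).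
have D0 : 0 <= b ^+ 2 - a * c by have := sqr_ge0 b; nra.
have dd : d ^+ 2 = b ^+ 2 - a * c by rewrite sqr_sqrtr.
have d0 : 0 <= d := sqrtr_ge0 _.
have d1 : `|b| < d.
  rewrite -(@ltr_pXn2r _ 2) ?nnegrE // dd real_normK ?num_real //; nra.
move: d1; rewrite ltr_norml => /andP[d1 d2].
exists ((- b + d) / c), ((- b - d) / c); split.
- by rewrite nmulr_llt0 ?invr_lt0 //; lra.
- by rewrite nmulr_lgt0 ?invr_lt0 //; lra.
- rewrite (_ : _ * _ = (b ^+ 2 - d ^+ 2) / c ^+ 2); last by field.
  by rewrite dd; field.
- rewrite (_ : _ + _ = a + (d ^+ 2 - b ^+ 2) / c); last by field.
  by rewrite dd; field.
- rewrite (_ : _ + _ = a + (d ^+ 2 - b ^+ 2) / c); last by field.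
  by rewrite dd; field.
Qed.

(** On the line [z1 + t z2] the form [N] vanishes at some [t1 < 0 < t2] with
    [t1 t2 = N(z1) / N(z2)], so [M] is positive at both points. In
    [t2 M(z1 + t1 z2) - t1 M(z1 + t2 z2) > 0] the cross terms cancel, which
    leaves [(t2 - t1) (M(z1) - t1 t2 M(z2)) > 0]. *)
Lemma S_lemma_ratio k (M N : 'M[R]_k) (z1 z2 : 'cV[R]_k) :
  M^T = M -> N^T = N ->
  (forall z, z != 0 -> 0 <= bform N z z -> 0 < bform M z z) ->
  0 < bform N z1 z1 -> bform N z2 z2 < 0 ->
  bform M z2 z2 / bform N z2 z2 < bform M z1 z1 / bform N z1 z1.
Proof.
move=> Ms Ns imp n1 n2.
have [t1 [t2 [t10 t20 tt e1 e2]]] := line_through_zero (bform N z1 z2) n1 n2.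
have exp (Q : 'M[R]_k) t : Q^T = Q ->
    bform Q (z1 + t *: z2) (z1 + t *: z2) =
    bform Q z1 z1 + 2 * t * bform Q z1 z2 + t ^+ 2 * bform Q z2 z2.
  move=> Qs; rewrite !(bformDl, bformDr, bformZl, bformZr) (bformC z2 z1 Qs).
  by ring.
have pos t : bform N z1 z1 + 2 * t * bform N z1 z2 + t ^+ 2 * bform N z2 z2 = 0 ->
    0 < bform M z1 z1 + 2 * t * bform M z1 z2 + t ^+ 2 * bform M z2 z2.
  rewrite -!exp // => e; apply: imp; last by rewrite e.
  apply: contraTneq n1 => /eqP; rewrite addr_eq0 => /eqP ->.
  rewrite -scaleNr bformZl bformZr -leNgt mulrA -expr2.
  by rewrite mulr_ge0_le0 ?sqr_ge0 // ltW.
have := pos _ e1; have := pos _ e2.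
move: (bform M _ _) (bform M _ _) (bform M _ _) => mb mc ma p2 p1.
rewrite ltr_pdivlMr // mulrAC -mulrA -tt.
have t12 : 0 < t2 - t1 by lra.
rewrite -subr_gt0 -(pmulr_rgt0 _ t12); nra.
Qed.

(** By [S_lemma_ratio] the ratios [M / N] over the vectors with [N < 0] lie
    below those over the vectors with [N > 0]; the multiplier is the supremum
    of the former. The value [0] is added to the set so that the multiplier is
    nonnegative; the vector with [N > 0] bounds the set from above. *)
Lemma S_lemma_slater k (M N : 'M[R]_k) :
  M^T = M -> N^T = N ->
  (forall z, z != 0 -> 0 <= bform N z z -> 0 < bform M z z) ->
  (exists z, 0 < bform N z z) ->
  exists2 alpha : R, 0 <= alpha & forall z, alpha * bform N z z <= bform M z z.
Proof.
move=> Ms Ns imp [z1 n1].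
pose ratio := [set r : R | r = 0 \/
  exists2 z, bform N z z < 0 & r = bform M z z / bform N z z].
have ub z : 0 < bform N z z -> ubound ratio (bform M z z / bform N z z).
  move=> nz r [->|[y ny ->]]; last by apply: ltW; apply: S_lemma_ratio.
  rewrite divr_ge0 ?(ltW nz) //; apply/ltW/imp; last exact: ltW.
  by apply: contraTneq nz => ->; rewrite bform0l ltxx.
have hs : has_sup ratio.
  by split; [exists 0; left | exists (bform M z1 z1 / bform N z1 z1); exact: ub].
exists (sup ratio); first by apply: ub_le_sup; [exact: hs.2 | left].
move=> z; have [nz|nz|nz] := ltrgtP (bform N z z) 0.
- rewrite -ler_ndivrMr //; apply: ub_le_sup; first exact: hs.2.
  by right; exists z.
- by rewrite -ler_pdivlMr //; apply: ge_sup; [exact: hs.1 | exact: ub].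
- rewrite nz mulr0; have [->|z0] := eqVneq z 0; first by rewrite bform0l.
  by apply/ltW/imp => //; rewrite nz.
Qed.

(** [max(M, -N)] is positive off [0], hence at least [mu |z|^2]. Then the
    implication persists for [N + (mu/2) I] and [M - (mu/2) I], and a
    multiplier for this pair serves the original one with a margin
    [(mu/2) |z|^2]. If the perturbed [N] is nowhere positive, then
    [N <= - (mu/2) I] and any large multiplier works. *)
Lemma S_lemma_strict k (M N : 'M[R]_k) :
  M^T = M -> N^T = N ->
  (forall z, z != 0 -> 0 <= bform N z z -> 0 < bform M z z) ->
  exists alpha beta : R, [/\ 0 <= alpha, 0 < beta &
    forall z, alpha * bform N z z + beta * bform 1%:M z z <= bform M z z].
Proof.
move=> Ms Ns imp.
have [mu mu0 bound] : exists2 mu : R, 0 < mu & forall z,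
    mu * bform 1%:M z z <= Num.max (bform M z z) (bform (- N) z z).
  apply: homogeneous_max_bound => z z0; rewrite lt_max bformMN oppr_gt0.
  by have [n0|n0] := leP 0 (bform N z z); [rewrite imp | rewrite orbT].
pose h := mu / 2; have h0 : 0 < h by rewrite divr_gt0.
have hmu : mu = 2 * h by rewrite /h; field.
have es (Q : 'M[R]_k) a : Q^T = Q -> (Q + a *: 1%:M)^T = Q + a *: 1%:M.
  by move=> Qs; rewrite linearD linearZ /= trmx1 Qs.
have [[z1 n1]|nn] := pselect (exists z, 0 < bform (N + h *: 1%:M) z z).
  have [] := @S_lemma_slater k (M + (- h) *: 1%:M) (N + h *: 1%:M).
  - exact: es.
  - exact: es.
  - move=> z z0; rewrite !bformMD !bformMZ; have := mulr_gt0 h0 (bform1_gt0 z0).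
    by have := bound z; rewrite bformMN hmu le_max -mulrA => /orP[]; lra.
  - by exists z1.
  move=> alpha a0 le; exists alpha, h; split=> // z; have := le z.
  rewrite !bformMD !bformMZ; have := bform1_ge0 z.
  move: (bform 1%:M z z) (bform N z z) (bform M z z) => a b c a1.
  have : 0 <= alpha * (h * a) by rewrite !mulr_ge0 // ltW.
  by lra.
have [c c0 cM] := bform_bounded M.
exists ((c + 1) / h), 1; split=> //; first by rewrite divr_ge0 // ?ltW // ltr_wpDr.
move/forallNP: nn => nn z; have /negP := nn z; rewrite -leNgt bformMD bformMZ => nz.
have /ler_normlP[+ _] := cM z.
have : (c + 1) / h * (bform N z z + h * bform 1%:M z z) <= 0.
  by rewrite mulr_ge0_le0 // divr_ge0 ?ltW // ltr_wpDr.
by rewrite mulrDr mulrA divfK ?gt_eqF //; lra.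
Qed.

End SLemma.

(** * Discrete-time Lyapunov stability *)

Section Stability.
Variable R : realType.
Implicit Types k l : nat.

(** Expand the nonnegative form [P] at [t w - P^-1 v]. *)
Lemma young_posdef k (P : 'M[R]_k) (w v : 'cV[R]_k) t : posdef P -> 0 < t ->
  2 * bform 1%:M w v <= t * bform P w w + t^-1 * bform (invmx P) v v.
Proof.
move=> Pp t0; have [Ps _] := Pp; have Pu := posdef_unitmx Pp.
have := posdef_ge0 (t *: w - invmx P *m v) Pp.
rewrite !(bformDl, bformDr, bformNl, bformNr, bformZl, bformZr).
rewrite (bformC (invmx P *m v) w Ps) !bform_mulmxr mulmxV //.
rewrite (bformC (invmx P *m v) v) ?trmx1 //.
rewrite bform_mulmxr mul1mx => h.
rewrite -(ler_pM2l t0) mulrDr (mulrA t t^-1) mulfV ?gt_eqF //; lra.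
Qed.

Lemma sqr_mx_norm_le k (v : 'cV[R]_k) : `|v| ^+ 2 <= bform 1%:M v v.
Proof.
have [->|v0] := eqVneq v 0; first by rewrite normr0 bform0l expr0n.
have /mx_norm_neq0[[i j] /= e] : mx_norm v != 0.
  by apply: contra_neq v0 => /mx_norm_eq0.
have -> : `|v| = `|v i j| by exact: e.
by rewrite real_normK ?num_real // (ord1 j) sqr_entry_le.
Qed.

Lemma bform1_le_sqr_mx_norm k (v : 'cV[R]_k) :
  bform 1%:M v v <= k%:R * `|v| ^+ 2.
Proof.
rewrite bform1_sum -[k in k%:R]card_ord -sumr_const mulr_suml.
apply: ler_sum => i _; rewrite mul1r -[leLHS]real_normK ?num_real //.
rewrite lerXn2r ?nnegrE //.
have : `|v i 0| <= mx_norm v.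
  rewrite mx_normrE; apply/bigmax_geP; right => /=.
  by exists (i, 0) => //; rewrite mem_index_enum.
by [].
Qed.

(** Put [z = P^-1 F v], so that [z^T P z] is both [(F v)^T P^-1 (F v)] and
    [(F^T z)^T v]. Weighting [young_posdef] by [1 / rho] bounds twice this
    number by [(1 / rho) (F^T z)^T P (F^T z) + rho v^T P^-1 v], whose first term
    is at most [z^T P z]. *)
Lemma lyapunov_contraction k (P F : 'M[R]_k) (rho : R) : posdef P -> 0 < rho ->
  (forall p, bform P (F^T *m p) (F^T *m p) <= rho * bform P p p) ->
  forall v, bform (invmx P) (F *m v) (F *m v) <= rho * bform (invmx P) v v.
Proof.
move=> Pp rho0 con v; have Pu := posdef_unitmx Pp.
have [Ps _] := Pp.
pose z := invmx P *m (F *m v).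
have Pz : P *m z = F *m v by rewrite /z mulKVmx.
have -> : bform (invmx P) (F *m v) (F *m v) = bform P z z.
  rewrite -Pz bform_mulmxr mulVmx // bformC ?trmx1 // -{2}(mul1mx P).
  by rewrite -bform_mulmxr.
have rho1 : 0 < rho^-1 by rewrite invr_gt0.
have := young_posdef (F^T *m z) v Pp rho1; rewrite invrK.
have -> : bform 1%:M (F^T *m z) v = bform P z z.
  rewrite -(mul1mx P) -bform_mulmxr Pz /bform !mulmx1 trmx_mul trmxK.
  by rewrite mulmxA.
have := con z; rewrite -ler_pdivrMl // => c1.
by rewrite [rho * _ in X in _ -> X]mulrC; lra.
Qed.

Lemma asymptotically_stable_of_decay k (F : 'M[R]_k) (kappa rho : R) :
  1 <= kappa -> 0 < rho < 1 ->
  (forall x : nat -> 'cV[R]_k, (forall t, x t.+1 = F *m x t) ->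
    forall t, `|x t| ^+ 2 <= kappa * rho ^+ t * `|x 0%N| ^+ 2) ->
  asymptotically_stable F.
Proof.
move=> k1 /andP[rho0 rho1] decay; have k0 : 0 < kappa := lt_le_trans ltr01 k1.
split.
  move=> e e0; exists (e / kappa); first by rewrite divr_gt0.
  move=> x tx; rewrite ltr_pdivlMr // => xe t; apply: le_lt_trans xe.
  rewrite -(@ler_pXn2r _ 2) ?nnegrE ?mulr_ge0 ?(ltW k0) //.
  apply: le_trans (decay x tx t) _; rewrite exprMn mulrC ler_wpM2l ?sqr_ge0 //.
  rewrite expr2 ler_pM2l //; apply: le_trans k1.
  by rewrite exprn_ile1 // ltW.
move=> x tx; apply/cvgr0Pnorm_lt => e e0.
have geo : (fun t => rho ^+ t) @ \oo --> (0 : R).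
  by apply: cvg_expr; rewrite ger0_norm // ltW.
have lim0 : (kappa * `|x 0%N| ^+ 2) * rho ^+ t @[t --> \oo] --> (0 : R).
  by rewrite -(mulr0 (kappa * `|x 0%N| ^+ 2)); exact: cvgM (cvg_cst _) geo.
have small := cvgr_lt _ lim0 (e ^+ 2) (exprn_gt0 2 e0).
apply: filterS (small _) => t lt.
rewrite -(@ltr_pXn2r _ 2) ?nnegrE ?(ltW e0) //.
by apply: le_lt_trans (decay x tx t) _; rewrite mulrAC.
Qed.

(** If [P <= c I] then [beta I >= (beta / c) P], so [F P F^T <= rho P] with
    [rho = 1 - beta / c]. Choosing [c = c0 + beta], with [c0] any bound for [P],
    keeps [rho] positive. *)
Lemma lyapunov_stable k (P F : 'M[R]_k) (beta : R) : posdef P -> 0 < beta ->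
  (forall p, beta * bform 1%:M p p <= bform (P - F *m P *m F^T) p p) ->
  asymptotically_stable F.
Proof.
move=> Pp beta0 dec.
have [c0 c00 Pc] := bform_bounded P.
have [d d0 Id] := bform_bounded (invmx P).
pose c := c0 + beta; have cp : 0 < c by rewrite addr_gt0.
pose rho := c0 / c; have rho0 : 0 < rho by rewrite divr_gt0.
have rho1 : rho < 1 by rewrite ltr_pdivrMr // mul1r ltrDl.
have Pc' p : bform P p p <= c * bform 1%:M p p.
  have /ler_normlP[_ le] := Pc p; apply: le_trans le _.
  by rewrite ler_wpM2r ?bform1_ge0 // lerDl ltW.
have con p : bform P (F^T *m p) (F^T *m p) <= rho * bform P p p.
  have := dec p; rewrite bformMD bformMN bform_congr => h.
  rewrite /rho mulrAC ler_pdivlMr //.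
  have : beta * bform P p p <= beta * (c * bform 1%:M p p).
    by rewrite ler_pM2l.
  have : c * (beta * bform 1%:M p p)
     <= c * (bform P p p - bform P (F^T *m p) (F^T *m p)) by rewrite ler_pM2l.
  by rewrite /c; lra.
have lower v : bform 1%:M v v <= c * bform (invmx P) v v.
  have c1 : 0 < c^-1 by rewrite invr_gt0.
  have := young_posdef v v Pp c1; rewrite invrK.
  have := Pc' v; rewrite -ler_pdivrMl //; lra.
have V x : (forall t, x t.+1 = F *m x t) -> forall t,
    bform (invmx P) (x t) (x t) <= rho ^+ t * bform (invmx P) (x 0%N) (x 0%N).
  move=> tx; elim=> [|t IH]; first by rewrite expr0 mul1r.
  rewrite tx exprS -mulrA.
  apply: le_trans (lyapunov_contraction Pp rho0 con _) _.
  by rewrite ler_pM2l.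
apply: (@asymptotically_stable_of_decay _ _ (1 + c * d * k%:R) rho).
- by rewrite lerDl !mulr_ge0 // ltW.
- by rewrite rho0.
move=> x tx t; apply: le_trans (sqr_mx_norm_le _) _.
apply: le_trans (lower _) _.
have /ler_normlP[_ ub] := Id (x 0%N).
have nb := bform1_le_sqr_mx_norm (x 0%N).
apply: (@le_trans _ _ (c * (rho ^+ t * (d * (k%:R * `|x 0%N| ^+ 2))))).
  rewrite ler_pM2l //; apply: le_trans (V x tx t) _.
  rewrite ler_pM2l ?exprn_gt0 //; apply: le_trans ub _.
  by rewrite ler_pM2l.
rewrite !mulrDl mul1r; apply: ler_wpDl.
  by rewrite mulr_ge0 ?exprn_ge0 // ltW.
by rewrite le_eqVlt; apply/orP; left; apply/eqP; ring.
Qed.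

End Stability.

(** * The matrix S-lemma *)

Definition qmi (R : realType) (n : nat) (N : 'M[R]_(n + n)) (A : 'M[R]_n) :
    'M[R]_n :=
  row_mx 1%:M A *m N *m (row_mx 1%:M A)^T.

Section MatrixSLemma.
Variables (R : realType) (n : nat).
Implicit Types (N M : 'M[R]_(n + n)) (A P : 'M[R]_n).

Lemma bform_qmi N A p :
  bform (qmi N A) p p = bform N (col_mx p (A^T *m p)) (col_mx p (A^T *m p)).
Proof. by rewrite bform_congr tr_row_mx mul_col_mx trmx1 mul1mx. Qed.

(** Completing the square centers the inequality at
    [Ac = - C S^-1]: with [Q] the Schur complement of [S] in [N] and
    [G = - S > 0], the condition on [A] reads [(A - Ac) G (A - Ac)^T <= Q], and
    the one on [(p, q)] reads [d^T G d <= p^T Q p] with [d = q - Ac^T p]. The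
    rank-one correction [Q p d^T / (p^T Q p)] maps [p] to [d] after
    transposition, and is admissible by the Cauchy-Schwarz inequality for [Q].
    If [p^T Q p = 0] then [d = 0] and [A = Ac] will do. *)
Lemma qmi_interpolation N A0 p q :
  N^T = N -> posdef (- drsubmx N) -> possemidef (qmi N A0) ->
  p != 0 -> 0 <= bform N (col_mx p q) (col_mx p q) ->
  exists2 A, possemidef (qmi N A) & A^T *m p = q.
Proof.
move=> Ns Gp [_ A0p] p0 pq0.
pose S := drsubmx N; pose C := ursubmx N.
have Gu := posdef_unitmx Gp.
have Su : S \in unitmx by rewrite -[S]opprK -scaleN1r unitmxZ ?unitrN1.
have [Ss Sneg] : S^T = S /\ forall v, bform S v v <= 0.
  split; first by rewrite /S trmx_drsub Ns.
  by move=> v; rewrite -oppr_ge0 -bformMN posdef_ge0.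
have Ne : N = block_mx (ulsubmx N) C C^T S.
  by rewrite /C trmx_ursub Ns submxK.
pose Q := ulsubmx N - C *m invmx S *m C^T.
pose Ac := - (C *m invmx S).
have Act : Ac^T = - (invmx S *m C^T) by rewrite linearN /= trmx_mul trmx_inv Ss.
have square x y : bform N (col_mx x y) (col_mx x y) =
    bform Q x x + bform S (y - Ac^T *m x) (y - Ac^T *m x).
  by rewrite {1}Ne bform_complete_square // Act mulNmx opprK.
have Qs : Q^T = Q.
  rewrite linearB /= trmx_ulsub Ns; congr (_ - _).
  by apply: sym_congr; rewrite trmx_inv Ss.
have Qp v : 0 <= bform Q v v.
  have := A0p v; rewrite -/(bform _ _ _) bform_qmi square.
  by have := Sneg (A0^T *m v - Ac^T *m v); lra.
have qs A : (qmi N A)^T = qmi N A by exact: sym_congr.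
set d := q - Ac^T *m p.
have dS : - bform S d d <= bform Q p p by move: pq0; rewrite square; lra.
(* Q vanishes at p exactly when the rank-one correction is undefined. *)
have [Qp0|Qp0] := eqVneq (bform Q p p) 0.
  exists Ac; first split=> // v.
    rewrite -/(bform _ _ _) bform_qmi square subrr bform0l addr0; exact: Qp.
  have : d == 0.
    apply: contraT => /(Gp.2 d); rewrite -/(bform _ _ _) bformMN.
    by move: dS; rewrite Qp0 -/S; lra.
  by rewrite subr_eq0 => /eqP.
have Qpp : 0 < bform Q p p by rewrite lt_def Qp0 Qp.
pose a := bform Q p p.
exists (Ac + a^-1 *: (Q *m p *m d^T)); last first.
  rewrite linearD linearZ /= !trmx_mul trmxK Qs mulmxDl -scalemxAl.
  rewrite -!mulmxA (mulmxA p^T) [p^T *m Q *m p]mx11_scalar.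
  rewrite mul_mx_scalar scalerA mulVf // scale1r addrC; exact: subrK.
split=> // v; rewrite -/(bform _ _ _) bform_qmi square.
have -> : (Ac + a^-1 *: (Q *m p *m d^T))^T *m v - Ac^T *m v =
          (a^-1 * bform Q p v) *: d.
  rewrite linearD linearZ /= mulmxDl addrAC subrr add0r.
  rewrite !trmx_mul trmxK Qs -scalemxAl -scalerA; congr (_ *: _).
  by rewrite -!mulmxA (mulmxA p^T) [p^T *m Q *m v]mx11_scalar mul_mx_scalar.
rewrite bformZl bformZr.
(* Cauchy-Schwarz: Q is nonnegative at a v - (p^T Q v) p. *)
have cs : (bform Q p v) ^+ 2 <= a * bform Q v v.
  have := Qp (a *: v - bform Q p v *: p).
  rewrite !(bformDl, bformDr, bformNl, bformNr, bformZl, bformZr).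
  rewrite (bformC v p Qs) -/a => h.
  by rewrite -(ler_pM2l Qpp) -/a; lra.
set b := bform Q p v in cs *; set e := bform S d d in dS *.
have a0 : 0 < a by [].
have : - ((a^-1 * b) * ((a^-1 * b) * e)) <= (a^-1 * b) ^+ 2 * a.
  rewrite mulrA -expr2 -mulrN ler_wpM2l ?sqr_ge0 //.
have : (a^-1 * b) ^+ 2 * a <= bform Q v v.
  rewrite exprMn exprVn mulrAC expr2 invfM -(mulrA a^-1) mulVf // mulr1.
  by rewrite ler_pdivrMl.
by lra.
Qed.

Lemma matrix_S_lemma N M A0 :
  N^T = N -> M^T = M -> posdef (- drsubmx N) -> possemidef (qmi N A0) ->
  (forall A, possemidef (qmi N A) -> posdef (qmi M A)) ->
  exists alpha beta : R, [/\ 0 <= alpha, 0 < beta &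
    forall z, alpha * bform N z z + beta * bform 1%:M z z <= bform M z z].
Proof.
move=> Ns Ms Gp A0p imp; apply: S_lemma_strict => // z z0.
rewrite -[z]vsubmxK; set p := usubmx z; set q := dsubmx z => Nz.
have [pe0|p0] := eqVneq p 0; last first.
  have [A Ap <-] := qmi_interpolation Ns Gp A0p p0 Nz.
  by rewrite -bform_qmi; apply: (imp A Ap).2.
have q0 : q != 0.
  by apply: contra_neq z0 => qe; rewrite -[z]vsubmxK -/p -/q pe0 qe col_mx0.
have := Gp.2 q q0; rewrite -/(bform _ _ _) bformMN ltNge.
have -> : bform (drsubmx N) q q = bform N (col_mx p q) (col_mx p q).
  rewrite -{2}[N]submxK /bform tr_col_mx pe0 trmx0 mul_row_block mul_row_col.
  by rewrite !mul0mx !add0r mulmx0 add0r.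
by rewrite oppr_le0 Nz.
Qed.

(** Let [g != 0] be a null vector of the lower right block and
    [h = (A0 + BK)^T g]. The stability inequality at [A0 + s g g^T], tested on
    [g], says [P(h + t g) < P(g)] for every [t]; this fails at [t = 1] or at
    [t = -1], since [P(h + g) + P(h - g) = 2 P(h) + 2 P(g)]. *)
Lemma qmi_curvature_posdef N P BK A0 :
  posdef P -> possemidef (- drsubmx N) ->
  (forall g : 'cV[R]_n, bform (drsubmx N) g g = 0 ->
     forall s, qmi N (A0 + s *: (g *m g^T)) = qmi N A0) ->
  possemidef (qmi N A0) ->
  (forall A, possemidef (qmi N A) ->
     posdef (P - (A + BK) *m P *m (A + BK)^T)) ->
  posdef (- drsubmx N).
Proof.
move=> Pp [Gs Gp] inv A0p stab; split=> // g g0.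
rewrite lt_def Gp andbT; apply/negP => /eqP; rewrite -/(bform _ _ _) bformMN.
move=> /eqP; rewrite oppr_eq0 => /eqP Gg.
pose h := (A0 + BK)^T *m g; pose r := bform 1%:M g g.
have r0 : 0 < r by exact: bform1_gt0.
have a0 : 0 < bform P g g by exact: Pp.2.
have lt t : bform P (h + t *: g) (h + t *: g) < bform P g g.
  have := A0p; rewrite -(inv g Gg (t / r)) => /stab[_ /(_ g g0)].
  rewrite -/(bform _ _ _) bformMD bformMN bform_congr subr_gt0.
  rewrite addrAC [(A0 + BK + _)^T]linearD mulmxDl -/h linearZ /= trmx_mul trmxK.
  rewrite -scalemxAl -mulmxA [g^T *m g]mx11_scalar mul_mx_scalar scalerA.
  have -> : (g^T *m g) 0 0 = r by rewrite /r /bform mulmx1.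
  by rewrite divfK ?gt_eqF.
have := lt 1; have := lt (-1); have := posdef_ge0 h Pp.
rewrite !(bformDl, bformDr, bformZl, bformZr) (bformC g h Pp.1); lra.
Qed.

End MatrixSLemma.

(** * Data-driven stabilization *)

Section Data.
Variables (R : realType) (n m T : nat) (B : 'M[R]_(n, m)).

(** The Schur complement of the last block of the LMI at [alpha = beta = 0]. *)
Definition closed_loop_schur (P : 'M[R]_n) (L : 'M[R]_(m, n)) : 'M[R]_(n + n) :=
  let C : 'M[R]_(n + n, n) := col_mx (B *m L) P in
  block_mx P 0 0 0 - C *m invmx P *m C^T.

Lemma qmi_closed_loop_schur P L A : posdef P ->
  qmi (closed_loop_schur P L) A =
  P - (A + B *m (L *m invmx P)) *m P *m (A + B *m (L *m invmx P))^T.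
Proof.
move=> Pp; have Pu := posdef_unitmx Pp; have [Ps _] := Pp.
rewrite /qmi /closed_loop_schur mulmxBr mulmxBl; congr (_ - _).
  by rewrite mul_row_block !mulmx0 mul1mx !addr0 tr_row_mx mul_row_col trmx1
             mulmx1 mul0mx addr0.
set F := A + _.
have FP : row_mx 1%:M A *m col_mx (B *m L) P = F *m P.
  by rewrite mul_row_col mul1mx mulmxDl -!mulmxA mulVmx // mulmx1 addrC.
transitivity ((F *m P) *m invmx P *m (F *m P)^T).
  by rewrite -FP trmx_mul !mulmxA.
by rewrite trmx_mul Ps mulmxK // mulmxA.
Qed.

Lemma stab_lmiP N P L alpha beta : N^T = N -> posdef P ->
  stab_lmi B N P L alpha beta <->
  forall z, alpha * bform N z z + beta * bform 1%:M (usubmx z) (usubmx z)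
            <= bform (closed_loop_schur P L) z z.
Proof.
move=> Ns Pp; have [Ps _] := Pp.
pose C : 'M[R]_(n + n, n) := col_mx (B *m L) P.
have Ct : C^T = row_mx (L^T *m B^T) P by rewrite tr_col_mx trmx_mul Ps.
pose Z := block_mx (P - beta%:M) 0 0 0 - alpha *: N.
have -> : stab_lmi B N P L alpha beta = possemidef (block_mx Z C C^T P).
  rewrite /stab_lmi Ct; congr possemidef.
  rewrite -scaleNr scale_block_mx !scaler0 add_block_mx !addr0 scaleNr.
  by [].
rewrite possemidef_schur //.
have Me : Z - C *m invmx P *m C^T =
    closed_loop_schur P L - block_mx beta%:M 0 0 0 - alpha *: N.
  have -> : Z = block_mx P 0 0 0 - block_mx beta%:M 0 0 0 - alpha *: N.
    by rewrite /Z opp_block_mx add_block_mx !oppr0 !addr0.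
  by rewrite -!addrA; congr (_ + _); rewrite [RHS]addrC -addrA; congr (_ + _);
     rewrite addrC.
rewrite Me.
have val z : bform (closed_loop_schur P L - block_mx beta%:M 0 0 0 - alpha *: N) z z
   = bform (closed_loop_schur P L) z z
     - beta * bform 1%:M (usubmx z) (usubmx z) - alpha * bform N z z.
  rewrite !bformMD !bformMN bformMZ; congr (_ - _ - _).
  rewrite -{1 2}[z]vsubmxK bform_col_mx0.
  by rewrite -(scalemx1 _ beta) bformMZ.
split=> [[_ h] z|h]; first by have := h z; rewrite -/(bform _ _ _) val; lra.
split; last by move=> z; rewrite -/(bform _ _ _) val; have := h z; lra.
rewrite !linearB /= linearZ /= Ns !tr_block_mx !trmx0 tr_scalar_mx Ps.
by congr (_ - _ - _ - _); apply: sym_congr; rewrite trmx_inv Ps.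
Qed.

Variables (Phi11 : 'M[R]_n) (Phi12 : 'M[R]_(n, T)) (Phi22 : 'M[R]_T).
Variables (U : 'M[R]_(m, T)) (X : 'M[R]_(n, T.+1)).
Let Phi : 'M[R]_(n + T) := block_mx Phi11 Phi12 Phi12^T Phi22.
Hypotheses (Phi11s : Phi11^T = Phi11) (Phi22s : Phi22^T = Phi22).
Let N := data_N B Phi U X.

Lemma data_N_sym : N^T = N.
Proof. by apply: sym_congr; rewrite tr_block_mx trmxK Phi11s Phi22s. Qed.

Lemma qmi_data_N A :
  let W := Xplus X - A *m Xminus X - B *m U in
  qmi N A = row_mx 1%:M W *m Phi *m (row_mx 1%:M W)^T.
Proof.
move=> W; rewrite /qmi /N /data_N.
set D := block_mx _ _ _ _.
have <- : row_mx 1%:M A *m D = row_mx 1%:M W.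
  by rewrite mul_row_block !mulmx1 !mul1mx mulmx0 addr0 mulmxN addrAC.
by rewrite trmx_mul !mulmxA.
Qed.

Lemma compatible_qmi A : compatible B Phi U X A <-> possemidef (qmi N A).
Proof.
by rewrite qmi_data_N /compatible /= /noise_bound tr_col_mx trmx1 trmxK
           tr_row_mx trmx1.
Qed.

Lemma drsubmx_data_N : drsubmx N = Xminus X *m Phi22 *m (Xminus X)^T.
Proof.
rewrite /N /data_N tr_block_mx !mulmx_block block_mxKdr.
rewrite !(trmx0, mul0mx, mulmx0, add0r, addr0) [(- Xminus X)^T]linearN /=.
by rewrite !mulNmx mulmxN opprK.
Qed.

(** The lower right block of [N] is [X_- Phi22 X_-^T] with [Phi22 < 0], so its
    null vectors satisfy [g^T X_- = 0], and [qmi N A] depends on [A] only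
    through [A X_-]. *)
Lemma qmi_data_N_invariant (g : 'cV[R]_n) A0 s :
  posdef (- Phi22) -> bform (drsubmx N) g g = 0 ->
  qmi N (A0 + s *: (g *m g^T)) = qmi N A0.
Proof.
move=> [_ Phip]; rewrite drsubmx_data_N bform_congr => e.
have Xg : (Xminus X)^T *m g = 0.
  apply/eqP; apply: contraT => /Phip; rewrite -/(bform _ _ _) bformMN e.
  by rewrite oppr0 ltxx.
have gX : g^T *m Xminus X = 0 by rewrite -[LHS]trmxK trmx_mul trmxK Xg trmx0.
have AX : (A0 + s *: (g *m g^T)) *m Xminus X = A0 *m Xminus X.
  by rewrite mulmxDl -scalemxAl -mulmxA gX mulmx0 scaler0 addr0.
by rewrite !qmi_data_N AX.
Qed.

Lemma lmi_of_informative A0 : posdef (- Phi22) -> compatible B Phi U X A0 ->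
  informative_quad_stab B Phi U X ->
  exists (P : 'M[R]_n) (L : 'M[R]_(m, n)) (alpha beta : R),
    [/\ posdef P, 0 <= alpha, 0 < beta & stab_lmi B N P L alpha beta].
Proof.
move=> Phip /compatible_qmi A0c [K [P [Pp stab]]].
have Pu := posdef_unitmx Pp; have [Ps _] := Pp.
have Ns := data_N_sym.
pose M := closed_loop_schur P (K *m P).
have qM A : qmi M A = P - (A + B *m K) *m P *m (A + B *m K)^T.
  by rewrite qmi_closed_loop_schur // mulmxK.
have Ms : M^T = M.
  rewrite linearB /= tr_block_mx !trmx0 Ps; congr (_ - _).
  by apply: sym_congr; rewrite trmx_inv Ps.
have Gp : possemidef (- drsubmx N).
  split; first by rewrite linearN /= trmx_drsub Ns.
  move=> v; rewrite -/(bform _ _ _) bformMN drsubmx_data_N bform_congr -bformMN.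
  exact: posdef_ge0.
have Gpd : posdef (- drsubmx N).
  apply: (@qmi_curvature_posdef _ _ N P (B *m K) A0) => //.
    by move=> g e s; exact: qmi_data_N_invariant.
  by move=> A /compatible_qmi; exact: stab.
have [A /compatible_qmi/stab|alpha [beta [a0 b0 le]]] :=
  matrix_S_lemma Ns Ms Gpd A0c.
  by rewrite qM.
exists P, (K *m P), alpha, beta; split=> //; apply/stab_lmiP => // z.
apply: le_trans (le z); rewrite lerD2l ler_pM2l //.
by rewrite -{3 4}[z]vsubmxK bform1_col_mx lerDl bform1_ge0.
Qed.

Lemma lmi_decrease P L alpha beta A : posdef P -> 0 <= alpha ->
  stab_lmi B N P L alpha beta -> compatible B Phi U X A ->
  let F := A + B *m (L *m invmx P) in
  forall p, beta * bform 1%:M p p <= bform (P - F *m P *m F^T) p p.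
Proof.
move=> Pp a0 /(stab_lmiP _ _ _ data_N_sym Pp) lmi /compatible_qmi[_ Ac] F p.
rewrite -qmi_closed_loop_schur // bform_qmi.
have := lmi (col_mx p (A^T *m p)); rewrite col_mxKu.
have := Ac p; rewrite -/(bform _ _ _) bform_qmi => Np.
by have := mulr_ge0 a0 Np; lra.
Qed.

End Data.

Theorem mainTheorem1 (R : realType) (r : nat) (n_ m_ : 'I_r -> nat) (T : nat)
    (B_ : forall i : 'I_r, 'M[R]_(n_ i, m_ i))
    (As : 'M[R]_(\sum_i n_ i))
    (x w : nat -> 'cV[R]_(\sum_i n_ i)) (u : nat -> 'cV[R]_(\sum_i m_ i))
    (Phi11 : 'M[R]_(\sum_i n_ i)) (Phi12 : 'M[R]_(\sum_i n_ i, T))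
    (Phi22 : 'M[R]_T) :
  let n := (\sum_i n_ i)%N in
  let m := (\sum_i m_ i)%N in
  let B : 'M[R]_(n, m) := block_diag B_ in
  let Phi : 'M[R]_(n + T) := block_mx Phi11 Phi12 Phi12^T Phi22 in
  let X : 'M[R]_(n, T.+1) := samples T.+1 x in
  let U : 'M[R]_(m, T) := samples T u in
  let W : 'M[R]_(n, T) := samples T w in
  let N : 'M[R]_(n + n) := data_N B Phi U X in
  Phi11^T = Phi11 ->
  Phi22^T = Phi22 ->
  posdef (- Phi22) ->
  (forall t : nat, (t < T)%N -> x t.+1 = As *m x t + B *m u t + w t) ->
  noise_bound Phi W ->
  (informative_quad_stab B Phi U X <->
     exists (P : 'M[R]_n) (L : 'M[R]_(m, n)) (alpha beta : R),
       [/\ posdef P, 0 <= alpha, 0 < beta & stab_lmi B N P L alpha beta]) /\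
  (forall (P : 'M[R]_n) (L : 'M[R]_(m, n)) (alpha beta : R),
     posdef P -> 0 <= alpha -> 0 < beta -> stab_lmi B N P L alpha beta ->
     forall A : 'M[R]_n, compatible B Phi U X A ->
       asymptotically_stable (A + B *m (L *m invmx P))).
Proof.
move=> n m B Phi X U W N Phi11s Phi22s Phip dyn noise.
have AsX : compatible B Phi U X As.
  rewrite /compatible /=.
  have -> : Xplus X - As *m Xminus X - B *m U = W; last exact: noise.
  have colM k (C : 'M[R]_(n, k)) (s : nat -> 'cV[R]_k) i (t : 'I_T) :
      (C *m samples T s) i t = (C *m s t) i 0.
    by rewrite !mxE; apply: eq_bigr => j _; rewrite mxE.
  have -> : Xminus X = samples T x by apply/matrixP => i t; rewrite !mxE.
  apply/matrixP => i t; rewrite [LHS]mxE [X in _ + X]mxE [X in X + _ = _]mxE.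
  rewrite [X in _ + X - _]mxE !colM !mxE /= /bump /= add1n dyn ?ltn_ord //.
  rewrite !mxE; ring.
split; last first.
  move=> P L alpha beta Pp a0 b0 lmi A Ac.
  exact: (lyapunov_stable Pp b0 (lmi_decrease Phi11s Phi22s Pp a0 lmi Ac)).
split; first exact: lmi_of_informative AsX.
move=> [P [L [alpha [beta [Pp a0 b0 lmi]]]]].
exists (L *m invmx P), P; split=> // A Ac.
have dec := lmi_decrease Phi11s Phi22s Pp a0 lmi Ac.
split; first by rewrite linearB /= Pp.1 sym_congr // Pp.1.
move=> v v0; apply: lt_le_trans (dec v).
by rewrite mulr_gt0 // bform1_gt0.
Qed.
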